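(* Let $\Pi\subseteq S_m$ be a set of permutation patterns. Then $$\delta(\Pi)=\lim_{n\to\infty}\frac{\max\{\nu(\Pi,\sigma):\sigma\in S_n\}}{\binom{n}{m}},$$ i.e. the packing density of $\Pi$ on words is equal to that on permutations.
   Context: $[k]=\{1,\dots,k\}$ and $[k]^n$ is the set of words of length $n$ over $[k]$; permutations in $S_n$ are regarded as words in $[n]^n$ with distinct letters. Two words $u,v$ of the same length are order-isomorphic if for all positions $i,j$: $u_i<u_j\iff v_i<v_j$. An occurrence of a pattern $\pi$ of length $m$ in a word $\sigma$ is a subsequence of $\sigma$ (a choice of positions $i_1<\dots<i_m$) order-isomorphic to $\pi$. For a set $\Pi$ of patterns of length $m$, $\nu(\Pi,\sigma)$ is the number of length-$m$ subsequences (position sets) of $\sigma$ that are an occurrence of some pattern in $\Pi$. For $n\ge m$, $\mu(\Pi,k,n)=\max\{\nu(\Pi,\sigma):\sigma\in[k]^n\}$ and $\delta(\Pi,k,n)=\mu(\Pi,k,n)/\binom{n}{m}$. For $k\ge n$ one has $\delta(\Pi,k,n)=\delta(\Pi,n,n)$. The packing density (on words) is $\delta(\Pi)=\lim_{n\to\infty}\delta(\Pi,n,n)=\lim_{n\to\infty}\lim_{k\to\infty}\delta(\Pi,k,n)$ (the limit exists). *)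

(* Defs.v *)
From HB Require Import structures.
From mathcomp Require Import all_boot all_order all_algebra all_fingroup.
From mathcomp Require Import all_classical all_reals all_analysis.

Set Implicit Arguments.
Unset Strict Implicit.
Unset Printing Implicit Defensive.

Import Order.TTheory GRing.Theory Num.Theory.
Import numFieldNormedType.Exports.

Local Open Scope ring_scope.

(* Letters and positions are numbered from 0: the alphabet [k] is 'I_k. *)
Definition word (k n : nat) := {ffun 'I_n -> 'I_k}.

Definition word_of_perm (n : nat) (s : 'S_n) : word n n := [ffun i => s i].

Definition order_isomorphic (k l m : nat) (u : word k m) (v : word l m) : bool :=
  [forall i, forall j, (u i < u j)%N == (v i < v j)%N].

(* A choice of positions i_1 < ... < i_m in a word of length n is encoded as
   the strictly increasing map j |-> i_j. *)
Definition positions (m n : nat) : {set {ffun 'I_m -> 'I_n}} :=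
  [set p : {ffun 'I_m -> 'I_n} |
      [forall i : 'I_m, forall j : 'I_m, (i < j)%N ==> (p i < p j)%N]].

Definition subword (k m n : nat) (s : word k n) (p : {ffun 'I_m -> 'I_n}) :
  word k m := [ffun j => s (p j)].

Definition nu (l m k n : nat) (Pi : {set word l m}) (s : word k n) : nat :=
  #|[set p in positions m n |
      [exists t in Pi, order_isomorphic t (subword s p)]]|.

Definition mu (l m : nat) (Pi : {set word l m}) (k n : nat) : nat :=
  (\max_(s : word k n) nu Pi s)%N.

(* For n < m the denominator is 0 and the quotient is 0 by convention; this
   does not affect limits in n. *)
Definition delta (R : realType) (l m : nat) (Pi : {set word l m})
  (k n : nat) : R := (mu Pi k n)%:R / 'C(n, m)%:R.

Definition packing_density (R : realType) (l m : nat) (Pi : {set word l m}) : R :=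
  limn (fun n : nat => delta R Pi n n).

Definition perm_delta (R : realType) (l m : nat) (Pi : {set word l m})
  (n : nat) : R :=
  (\max_(s : 'S_n) nu Pi (word_of_perm s))%N%:R / 'C(n, m)%:R.

(* Main.v *)
Require Import Defs.
From HB Require Import structures.
From mathcomp Require Import all_boot all_order all_algebra all_fingroup.
From mathcomp Require Import all_classical all_reals all_analysis.

Set Implicit Arguments.
Unset Strict Implicit.
Unset Printing Implicit Defensive.

Import Order.TTheory GRing.Theory Num.Theory.
Import numFieldNormedType.Exports.

Local Open Scope ring_scope.

(** A pattern with distinct letters only ever occurs at positions carrying
    distinct letters, so the order among equal letters of a word is irrelevant
    to its occurrences.  Breaking ties, for instance from left to right, turns
    any word of length [n], over an alphabet of any size, into a permutation
    that keeps all occurrences ([word_refinement], [nu_le_perm]).  Hence the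
    maximum over words and the maximum over permutations agree for every [n]
    ([mu_perm]), and the two sequences of densities are equal term by term.

    Their common limit exists because the densities do not increase from [n = m]
    on.  Deleting one of the [n + 1] letters of a word kills exactly the occurrences
    that use it, and each occurrence survives [n + 1 - m] of the deletions;
    averaging over the deleted letter ([nu_delete]) bounds the density at
    [n + 1] by the one at [n] ([perm_delta_nonincreasing]). *)

Notation perm_patterns P := [set word_of_perm u | u in P].

Definition occurrences (l m k n : nat) (Pi : {set word l m}) (s : word k n) :
    {set {ffun 'I_m -> 'I_n}} :=
  [set p in positions m n |
      [exists t in Pi, order_isomorphic t (subword s p)]].

(** The image under [f] of an index is replaced by its rank among all images. *)
Lemma inj_standardization (n : nat) (f : 'I_n -> nat) :
  injective f -> exists t : 'S_n, forall i j, (f i < f j)%N -> (t i < t j)%N.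
Proof.
move=> f_inj.
pose below i := [set j : 'I_n | (f j < f i)%N].
have rank_lt i : (#|below i| < n)%N.
  rewrite -[ltnRHS]card_ord -cardsT; apply: proper_card.
  by apply/properP; split; [exact: finset.subsetT | exists i; rewrite !inE ?ltnn].
pose rank i := Ordinal (rank_lt i).
have rank_mono i j : (f i < f j)%N -> (rank i < rank j)%N.
  move=> fij; apply: proper_card; apply/properP; split.
    by apply/fintype.subsetP => h; rewrite !inE => /ltn_trans; apply.
  by exists i; rewrite !inE ?ltnn.
have rank_inj : injective rank.
  move=> i j eq_ij; apply: f_inj.
  by case: (ltngtP (f i) (f j)) => // /rank_mono; rewrite eq_ij ltnn.
by exists (perm rank_inj) => i j /rank_mono; rewrite !permE.
Qed.

(** Ties are broken from left to right. *)
Lemma word_refinement (k n : nat) (s : word k n) :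
  exists t : 'S_n, forall i j, (s i < s j)%N -> (t i < t j)%N.
Proof.
(* This number orders the pairs (s i, i) lexicographically, as i < n. *)
pose key (i : 'I_n) := (s i * n + i)%N.
have key_inj : injective key.
  move=> i j eq_ij; apply: val_inj => /=.
  by have := congr1 (modn^~ n) eq_ij; rewrite /key !modnMDl !modn_small.
have [t t_mono] := inj_standardization key_inj.
exists t => i j sij; apply: t_mono.
apply: leq_trans (leq_trans (leq_mul sij (leqnn n)) (leq_addr j _)).
by rewrite /key mulSn [ltnRHS]addnC ltn_add2l.
Qed.

(** Strict inequalities in a pattern with distinct letters decide all its
    comparisons, so a refinement of the order of the letters keeps them. *)
Lemma nu_le_perm (m k n : nat) (P : {set 'S_m}) (s : word k n) :
  exists t : 'S_n,
    (nu (perm_patterns P) s <= nu (perm_patterns P) (word_of_perm t))%N.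
Proof.
have [t t_mono] := word_refinement s.
exists t; apply: subset_leq_card; apply/fintype.subsetP => p.
rewrite !inE => /andP[-> /=] /exists_inP[_ /imsetP[u uP ->] iso_u].
apply/exists_inP; exists (word_of_perm u); first exact: imset_f.
have {iso_u}iso i j : (u i < u j)%N = (s (p i) < s (p j))%N.
  by move/forallP/(_ i)/forallP/(_ j)/eqP: iso_u; rewrite !ffunE.
apply/forallP => i; apply/forallP => j; rewrite !ffunE; apply/eqP.
case: (ltngtP (u i) (u j)) => [||/val_inj/perm_inj ->]; last by rewrite ltnn.
  by rewrite iso => /t_mono ->.
by rewrite iso => /t_mono /ltnW; rewrite leqNgt => /negbTE ->.
Qed.

Definition perm_mu (l m : nat) (Pi : {set word l m}) (n : nat) : nat :=
  (\max_(s : 'S_n) nu Pi (word_of_perm s))%N.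

Lemma nu_le_perm_mu (m k n : nat) (P : {set 'S_m}) (s : word k n) :
  (nu (perm_patterns P) s <= perm_mu (perm_patterns P) n)%N.
Proof.
have [t le_st] := nu_le_perm P s.
exact: leq_trans le_st (leq_bigmax (F := fun t => nu _ (word_of_perm t)) t).
Qed.

Lemma mu_perm (m n : nat) (P : {set 'S_m}) :
  mu (perm_patterns P) n n = perm_mu (perm_patterns P) n.
Proof.
apply/eqP; rewrite eqn_leq; apply/andP; split.
  by apply/bigmax_leqP => s _; exact: nu_le_perm_mu.
apply/bigmax_leqP => t _.
exact: (leq_bigmax (F := fun s : word n n => nu _ s)).
Qed.

Definition delete_letter (k n : nat) (h : 'I_n.+1) (s : word k n.+1) :
  word k n := [ffun i => s (lift h i)].

Lemma positions_inj (m n : nat) (p : {ffun 'I_m -> 'I_n}) :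
  p \in positions m n -> injective p.
Proof.
rewrite inE => /forallP p_incr i j eq_p; apply: val_inj.
case: (ltngtP i j) => // lt_ij.
  by have /forallP/(_ j) := p_incr i; rewrite lt_ij eq_p ltnn.
by have /forallP/(_ i) := p_incr j; rewrite lt_ij eq_p ltnn.
Qed.

(** An occurrence that avoids position [h] is the image under [lift h] of an
    occurrence in the shortened word. *)
Lemma card_occurrences_avoiding (l m k n : nat) (Pi : {set word l m})
    (s : word k n.+1) (h : 'I_n.+1) :
  (#|[set p in occurrences Pi s | h \notin codom p]|
     <= nu Pi (delete_letter h s))%N.
Proof.
pose shift (q : {ffun 'I_m -> 'I_n}) : {ffun 'I_m -> 'I_n.+1} :=
  [ffun i => lift h (q i)].
apply: (leq_trans _ (leq_imset_card shift _)).
apply: subset_leq_card; apply/fintype.subsetP => p.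
rewrite !inE => /andP[/andP[p_incr occ_p] avoid].
have p_neq i : h != p i by apply: contraNneq avoid => ->; exact: codom_f.
pose q : {ffun 'I_m -> 'I_n} := [ffun i => sval (unlift_some (p_neq i))].
have lift_q i : lift h (q i) = p i.
  by rewrite ffunE; case: (unlift_some (p_neq i)) => /= j ->.
apply/imsetP; exists q; last by apply/ffunP => i; rewrite ffunE lift_q.
rewrite !inE; apply/andP; split.
  apply/forallP => i; apply/forallP => j; apply/implyP => lt_ij.
  have /forallP/(_ i)/forallP/(_ j)/implyP/(_ lt_ij) := p_incr.
  by rewrite -!lift_q /= !ltnNge leq_bump2.
suff -> : subword (delete_letter h s) q = subword s p by [].
by apply/ffunP => i; rewrite [LHS]ffunE [LHS]ffunE [RHS]ffunE lift_q.
Qed.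

(** Double counting of the pairs of an occurrence and a position it avoids. *)
Lemma nu_delete (l m k n : nat) (Pi : {set word l m}) (s : word k n.+1) :
  (nu Pi s * (n.+1 - m) <= \sum_(h < n.+1) nu Pi (delete_letter h s))%N.
Proof.
apply: (@leq_trans (\sum_(h < n.+1)
    #|[set p in occurrences Pi s | h \notin codom p]|)%N); last first.
  by apply: leq_sum => h _; exact: card_occurrences_avoiding.
rewrite (eq_bigr (fun h => \sum_(p in occurrences Pi s) (h \notin codom p))%N);
  last first.
  move=> h _; rewrite -sum1_card [RHS]big_mkcond [LHS]big_mkcond /=.
  by apply: eq_bigr => p _; rewrite inE; case: (p \in _); case: (h \notin _).
rewrite exchange_big /= /nu -/(occurrences Pi s) -sum_nat_const.
apply: leq_sum => p; rewrite inE => /andP[/positions_inj p_inj _].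
have <- : #|[predC codom p]| = (n.+1 - m)%N.
  have := cardC (mem (codom p)); rewrite card_codom // !card_ord.
  by move/(congr1 (subn^~ m)); rewrite addKn.
rewrite -sum1_card big_mkcond /=.
by apply: leq_sum => h _; rewrite !inE; case: (h \in _).
Qed.

(** A permutation of [n + 1] points that loses a letter is a word of length [n]
    over [n + 1] letters, no longer a permutation; the bound [nu_le_perm_mu],
    which holds over every alphabet, takes it back to permutations. *)
Lemma perm_mu_delete (m n : nat) (P : {set 'S_m}) :
  (perm_mu (perm_patterns P) n.+1 * (n.+1 - m)
     <= n.+1 * perm_mu (perm_patterns P) n)%N.
Proof.
have card_gt0 : (0 < #|{perm 'I_n.+1}|)%N by rewrite card_Sn fact_gt0.
rewrite /perm_mu; have [t ->] := bigop.eq_bigmax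
  (fun t : 'S_n.+1 => nu (perm_patterns P) (word_of_perm t)) card_gt0.
apply: (leq_trans (nu_delete _ _)).
rewrite -[in leqRHS](card_ord n.+1) -sum_nat_const.
by apply: leq_sum => h _; exact: nu_le_perm_mu.
Qed.

Lemma perm_delta_nonincreasing (R : realType) (m n : nat) (P : {set 'S_m}) :
  (m <= n)%N ->
  perm_delta R (perm_patterns P) n.+1 <= perm_delta R (perm_patterns P) n.
Proof.
move=> le_mn; rewrite /perm_delta -!/(perm_mu _ _).
rewrite ler_pdivrMr ?ltr0n ?bin_gt0 ?leqW // mulrAC.
rewrite ler_pdivlMr ?ltr0n ?bin_gt0 // -!natrM ler_nat.
have gt0 : (0 < n.+1 - m)%N by rewrite subn_gt0 ltnS.
rewrite -(leq_pmul2r gt0) mulnAC -[leqRHS]mulnA.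
rewrite [('C(n.+1, m) * _)%N]mulnC -mul_bin_down mulnA leq_mul2r.
by rewrite [(perm_mu _ _ * n.+1)%N]mulnC perm_mu_delete orbT.
Qed.

Theorem theorem1p4 (R : realType) (m : nat) (P : {set 'S_m}) :
  let Pi : {set word m m} := [set word_of_perm s | s in P] in
  [/\ cvgn (fun n : nat => delta R Pi n n),
      cvgn (perm_delta R Pi) &
      packing_density R Pi = limn (perm_delta R Pi)].
Proof.
move=> Pi.
have eq_delta : (fun n => delta R Pi n n) = perm_delta R Pi.
  by apply/funext => n; rewrite /delta mu_perm.
have cvg_delta : cvgn (perm_delta R Pi).
  apply: (@near_nonincreasing_is_cvgn _ _ 0); last first.
    by apply: nearW => n; rewrite divr_ge0.
  exists m => // n /= le_mn j le_nj.
  elim: j le_nj => [|j IHj].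
    by rewrite leqn0 => /eqP ->.
  rewrite leq_eqVlt => /predU1P[-> //|]; rewrite ltnS => le_nj.
  apply: le_trans (IHj le_nj).
  exact: perm_delta_nonincreasing (leq_trans le_mn le_nj).
by rewrite /packing_density eq_delta.
Qed.
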